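(* Let $\mathcal{X}$ be a $d$-dimensional compact, connected Riemannian manifold and let $f\in C^\gamma(\mathcal{X})$, $\gamma\in(0,1)$, be real-valued. Then $$\overline{\dim}_M\left(\mathrm{Graph}(f)\right)\le(d+1)-\gamma.$$
   Context: $\mathcal{X}$ is a metric space with its Riemannian distance $\rho$. $f\in C^\gamma(\mathcal{X})$ means that there is $C>0$ with $|f(x)-f(y)|\le C\,\rho(x,y)^\gamma$ for all $x,y\in\mathcal{X}$. $\mathrm{Graph}(f)=\{(x,f(x)):x\in\mathcal{X}\}\subset\mathcal{X}\times\mathbb{R}$, with the product metric. Upper Minkowski dimension: for a totally bounded subset $E$ of a metric space, $\mathcal{N}_\varepsilon(E)$ is the smallest number of metric balls of radii $\le\varepsilon$ that cover $E$, and $\overline{\dim}_M(E):=\limsup_{\varepsilon\to0}\frac{\log\mathcal{N}_\varepsilon(E)}{\log(1/\varepsilon)}$. *)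

(* Defs.v *)
From HB Require Import structures.
From mathcomp Require Import all_boot all_order all_algebra.
From mathcomp Require Import all_classical all_reals all_analysis.

Set Implicit Arguments.
Unset Strict Implicit.
Unset Printing Implicit Defensive.

Import Order.TTheory GRing.Theory Num.Theory.
Import numFieldNormedType.Exports.

Local Open Scope classical_set_scope.
Local Open Scope ring_scope.

(* C^k on a set U, which is meant to be open: total derivatives up to order k
   exist at every point of U, and the derivatives of order k are continuous
   there. *)
Fixpoint Ck_on (R : realType) (V W : normedModType R) (k : nat) (U : set V)
    (f : V -> W) : Prop :=
  if k is k'.+1 then
    (forall p, U p -> differentiable f p) /\
    (forall v, Ck_on k' U (fun p => 'D_v f p))
  else forall p, U p -> {for p, continuous f}.

Definition smooth_on (R : realType) (V W : normedModType R) (U : set V)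
    (f : V -> W) : Prop :=
  forall k, Ck_on k U f.

(* A homeomorphism cmap from the open set cdom onto the open set
   cmap @` cdom of R^d.  cmap and cinv are total functions whose values
   outside these two sets are irrelevant. *)
Record chart (R : realType) (d : nat) (X : topologicalType) := Chart {
  cdom : set X;
  cmap : X -> 'rV[R]_d;
  cinv : 'rV[R]_d -> X;
  cdom_open : open cdom;
  cimg_open : open (cmap @` cdom);
  cmapK : forall x, cdom x -> cinv (cmap x) = x;
  cmap_continuous : forall x, cdom x -> {for x, continuous cmap};
  cinv_continuous : forall p, (cmap @` cdom) p -> {for p, continuous cinv}
}.

(* Smooth d-dimensional manifolds without boundary, given by a smooth (not
   necessarily maximal) atlas. *)
Record smooth_manifold (R : realType) (d : nat) (X : topologicalType) :=
    SmoothManifold {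
  atlas : set (chart R d X);
  man_hausdorff : hausdorff_space X;
  man_second_countable : @second_countable X;
  atlas_cover : forall x : X, exists2 c, atlas c & cdom c x;
  atlas_smooth : forall c1 c2, atlas c1 -> atlas c2 ->
    smooth_on (cmap c1 @` (cdom c1 `&` cdom c2)) (cmap c2 \o cinv c1)
}.

Definition bilin (R : realType) (d : nat) (G : 'M[R]_d) (u v : 'rV[R]_d) : R :=
  (u *m G *m v^T) 0 0.

(* metric c p is the Gram matrix (g_ab) of the Riemannian metric in the
   coordinates of c, at the point with coordinates p; metric_compat is the
   transformation law of a covariant 2-tensor under a change of chart. *)
Record riemannian_manifold (R : realType) (d : nat) (X : topologicalType) :=
    RiemannianManifold {
  man :> smooth_manifold R d X;
  metric : chart R d X -> 'rV[R]_d -> 'M[R]_d;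
  metric_smooth : forall c, atlas man c -> forall a b : 'I_d,
    smooth_on (cmap c @` cdom c) (fun p => metric c p a b : R^o);
  metric_symmetric : forall c, atlas man c -> forall p, (cmap c @` cdom c) p ->
    (metric c p)^T = metric c p;
  metric_posdef : forall c, atlas man c -> forall p, (cmap c @` cdom c) p ->
    forall v : 'rV[R]_d, v != 0 -> 0 < bilin (metric c p) v v;
  metric_compat : forall c1 c2, atlas man c1 -> atlas man c2 ->
    forall x, cdom c1 x -> cdom c2 x -> forall u v : 'rV[R]_d,
    bilin (metric c1 (cmap c1 x)) u v =
    bilin (metric c2 (cmap c2 x))
      ('D_u (cmap c2 \o cinv c1) (cmap c1 x))
      ('D_v (cmap c2 \o cinv c1) (cmap c1 x))
}.

Definition chart_at (R : realType) (d : nat) (X : topologicalType)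
    (M : smooth_manifold R d X) (x : X) : chart R d X :=
  s2val (cid2 (atlas_cover M x)).

(* C^1 on the closed interval [0, 1], i.e. on an open neighbourhood of it. *)
Definition C1_curve (R : realType) (d : nat) (X : topologicalType)
    (M : smooth_manifold R d X) (c : R -> X) : Prop :=
  exists U : set R, [/\ open U, `[0, 1] `<=` U &
    forall t, U t -> {for t, continuous c} /\
      forall h, atlas M h -> cdom h (c t) ->
        derivable (cmap h \o c) t 1 /\
        {for t, continuous (derive1 (cmap h \o c))}].

(* Norm of the velocity of c at time t; by metric_compat it does not depend on
   the chart around c t. *)
Definition speed (R : realType) (d : nat) (X : topologicalType)
    (M : riemannian_manifold R d X) (c : R -> X) (t : R) : R :=
  let h := chart_at M (c t) in
  let v := derive1 (cmap h \o c) t in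
  Num.sqrt (bilin (metric M h (cmap h (c t))) v v).

(* s is a piecewise C^1 path from x to y: a list of C^1 curves on [0, 1], each
   starting where the previous one ends. *)
Fixpoint piecewise_C1_path (R : realType) (d : nat) (X : topologicalType)
    (M : smooth_manifold R d X) (x y : X) (s : seq (R -> X)) : Prop :=
  if s is c :: s' then
    [/\ C1_curve M c, c 0 = x & piecewise_C1_path M (c 1) y s']
  else x = y.

Definition path_length (R : realType) (d : nat) (X : topologicalType)
    (M : riemannian_manifold R d X) (s : seq (R -> X)) : R :=
  \sum_(c <- s) \int[lebesgue_measure]_(t in `[0, 1]) speed M c t.

(* On a connected manifold the set below is nonempty, so that inf is a genuine
   infimum. *)
Definition riem_dist (R : realType) (d : nat) (X : topologicalType)
    (M : riemannian_manifold R d X) (x y : X) : R :=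
  inf [set path_length M s | s in piecewise_C1_path M x y].

Definition hoelder_continuous (R : realType) (X : Type) (rho : X -> X -> R)
    (gamma : R) (f : X -> R) : Prop :=
  exists2 C : R, 0 < C & forall x y, `|f x - f y| <= C * rho x y `^ gamma.

Definition graph (X Y : Type) (f : X -> Y) : set (X * Y) :=
  range (fun x => (x, f x)).

(* The product metric is the maximum metric, as in the library. *)
Definition prod_dist (R : realType) (X Y : Type) (rhoX : X -> X -> R)
    (rhoY : Y -> Y -> R) (p q : X * Y) : R :=
  Num.max (rhoX p.1 q.1) (rhoY p.2 q.2).

Definition abs_dist (R : realType) (s t : R) : R := `|s - t|.

Definition covered_by_balls (R : realType) (T : Type) (rho : T -> T -> R)
    (E : set T) (eps : R) (n : nat) : Prop :=
  exists (z : 'I_n -> T) (r : 'I_n -> R),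
    (forall i, 0 < r i <= eps) /\
    E `<=` \bigcup_i [set y | rho (z i) y < r i].

(* +oo when no finite number of balls covers E. *)
Definition covering_number (R : realType) (T : Type) (rho : T -> T -> R)
    (E : set T) (eps : R) : \bar R :=
  ereal_inf [set n%:R%:E | n in covered_by_balls rho E eps].

Definition upper_minkowski_dim (R : realType) (T : Type) (rho : T -> T -> R)
    (E : set T) : \bar R :=
  limf_esup
    (fun eps : R => (lne (covering_number rho E eps) / (ln eps^-1)%:E)%E)
    0^'+.

(* Main.v *)
Require Import Defs.
From mathcomp Require Import all_boot all_order all_algebra.
From mathcomp Require Import all_classical all_reals all_analysis.
From mathcomp Require Import ring lra.
Import Order.TTheory GRing.Theory Num.Theory.
Import numFieldNormedType.Exports.
Local Open Scope classical_set_scope.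
Local Open Scope ring_scope.

(** Around each point of the manifold there is a coordinate cube on which the
    entries of the metric tensor are bounded.  A straight segment of the cube
    then lifts to a curve whose length is at most a constant times the length
    of the segment, so that the parametrization of the cube is Lipschitz for
    the Riemannian distance ([chart_cube_lipschitz]).

    Over one such cube the graph is covered as follows
    ([covering_growth_graph_cube]).  Cut the cube into about [eps^-d] cells
    whose images have Riemannian radius less than [eps].  On each cell a Hoelder
    function stays within [C * eps^gamma] of its value at the centre, so about
    [eps^(gamma - 1)] heights with gaps of order [eps] suffice above it.  In
    the maximum metric this makes at most [K * eps^-(d + 1 - gamma)] balls of
    radius [eps].

    Having such a polynomial bound is stable under subsets and finite unions,
    so by compactness it passes from the cubes to the whole graph
    ([compact_local_to_global]).  On taking logarithms the constant [K]
    disappears in the limit, and the exponent bounds the upper Minkowski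
    dimension ([covering_growth_dim]). *)

(** * Covering numbers of polynomial growth *)

(** An explicit bound for every [eps] replaces the limit superior because,
    unlike [upper_minkowski_dim], it can be added over the pieces of a set. *)
Definition covering_growth {R : realType} {T : Type} (rho : T -> T -> R)
    (E : set T) (s : R) : Prop :=
  exists K : R, forall eps, 0 < eps < 1 ->
    exists2 n, covered_by_balls rho E eps n & n%:R <= K * eps `^ (- s).

(** From [N_eps <= K * eps^-s] one gets
    [log N_eps / log (1/eps) <= s + log K / log (1/eps)], and the last term is
    at most any given [e > 0] once [eps < expR (- (ln K / e))]. *)
Lemma covering_growth_dim {R : realType} {T : Type} (rho : T -> T -> R)
    (E : set T) (s : R) :
  covering_growth rho E s -> (upper_minkowski_dim rho E <= s%:E)%E.
Proof.
move=> [K0 HK0]; pose K := Num.max K0 1.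
(* Enlarging the constant to at least 1 makes its logarithm nonnegative. *)
have K1 : 1 <= K by rewrite /K le_max lexx orbT.
have Kgt0 : 0 < K by exact: lt_le_trans K1.
apply/lee_addgt0Pr => e e0.
pose delta := expR (- (ln K / e)).
have lnK0 : 0 <= ln K by rewrite ln_ge0.
have delta0 : 0 < delta by exact: expR_gt0.
have delta1 : delta <= 1 by rewrite -expR0 ler_expR oppr_le0 divr_ge0// ltW.
rewrite /upper_minkowski_dim /limf_esup.
apply: ge_ereal_inf.
exists (ereal_sup [set (lne (covering_number rho E eps) / (ln eps^-1)%:E)%E
                  | eps in `]0, delta[ ]).
  exists `]0, delta[%classic => //.
  near=> x; rewrite /= in_itv/=; apply/andP; split.
    by near: x; exact: nbhs_right_gt.
  by near: x; exact: nbhs_right_lt.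
apply: ge_ereal_sup => _ [eps /= + <-].
rewrite in_itv/= => /andP[eps0 epsd].
have eps1 : eps < 1 by exact: lt_le_trans delta1.
have [n covn nK] := HK0 eps (introT andP (conj eps0 eps1)).
have Veps : ln eps^-1 = - ln eps by rewrite lnV// posrE.
have l0 : 0 < ln eps^-1 by rewrite Veps oppr_gt0 ln_lt0// eps0.
have lK : ln K <= e * ln eps^-1.
  rewrite mulrC -ler_pdivrMr// Veps -lerN2 opprK -[leRHS]expRK ler_ln ?posrE//.
  exact: ltW.
rewrite inver gt_eqF// lee_pdivrMr//.
have pow0 : 0 < eps `^ (- s) by exact: powR_gt0.
have covle : (covering_number rho E eps <= (K * eps `^ (- s))%:E)%E.
  apply: ge_ereal_inf; exists n%:R%:E; first by exists n.
  rewrite lee_fin (le_trans nK)// ler_wpM2r ?(ltW pow0)//.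
  by rewrite /K le_max lexx.
have cov0 : (0 <= covering_number rho E eps)%E.
  by apply: le_ereal_inf_tmp => _ [m _ <-]; rewrite lee_fin.
apply: (@le_trans _ _ (lne (K * eps `^ (- s))%:E)).
  rewrite lee_lne// in_itv/= ?cov0 ?leey//.
  by rewrite lee_fin mulr_ge0 ?leey// ltW.
rewrite lne_EFin ?mulr_gt0// lnM ?posrE// ln_powR -EFinD -EFinM lee_fin.
by rewrite mulrDl mulNr -mulrN -Veps addrC lerD2l.
Unshelve. all: by end_near. Qed.

Lemma covered_by_finType {R : realType} {T : Type} {rho : T -> T -> R}
    {E : set T} {eps : R} (I : finType) (z : I -> T) (r : I -> R) :
  (forall i, 0 < r i <= eps) ->
  (forall y, E y -> exists i, rho (z i) y < r i) ->
  covered_by_balls rho E eps #|I|.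
Proof.
move=> reps cov; exists (z \o enum_val), (r \o enum_val); split.
  by move=> i; exact: reps.
move=> y /cov[i zi]; exists (enum_rank i) => //=.
by rewrite enum_rankK.
Qed.

Lemma covering_growthU {R : realType} {T : Type} (rho : T -> T -> R)
    (E1 E2 : set T) (s : R) :
  covering_growth rho E1 s -> covering_growth rho E2 s ->
  covering_growth rho (E1 `|` E2) s.
Proof.
move=> [K1 H1] [K2 H2]; exists (K1 + K2) => eps eps01.
have [n1 [z1 [r1 [r1eps cov1]]] n1K] := H1 _ eps01.
have [n2 [z2 [r2 [r2eps cov2]]] n2K] := H2 _ eps01.
exists (n1 + n2)%N; last by rewrite natrD mulrDl lerD.
have -> : (n1 + n2)%N = #|{: 'I_n1 + 'I_n2}| by rewrite card_sum !card_ord.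
apply: (covered_by_finType _
  (fun i => match i with inl j => z1 j | inr j => z2 j end)
  (fun i => match i with inl j => r1 j | inr j => r2 j end)).
  by case.
by move=> y [/cov1[i _ yi]|/cov2[i _ yi]]; [exists (inl i)|exists (inr i)].
Qed.

Lemma covering_growthS {R : realType} {T : Type} (rho : T -> T -> R)
    (E1 E2 : set T) (s : R) : E1 `<=` E2 ->
  covering_growth rho E2 s -> covering_growth rho E1 s.
Proof.
move=> E12 [K HK]; exists K => eps /HK[n [z [r [reps cov]]] nK].
by exists n => //; exists z, r; split=> // y /E12/cov.
Qed.

Lemma covering_growth0 {R : realType} {T : Type} (rho : T -> T -> R) (s : R) :
  covering_growth rho set0 s.
Proof.
exists 0 => eps eps01; exists 0%N; last by rewrite mul0r.
by exists (fun i : 'I_0 => False_rect T (notF (ltn_ord i))), (fun=> eps);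
  split=> // -[].
Qed.

(** * Grids on intervals and cubes *)

(** The centres of the [n] subintervals of length [2 * r / n] of
    [(a - r, a + r)] are the grid points; the first one is [a - r + r / n].
    They stay in the open interval, so that a grid of a cube stays inside it. *)
Lemma interval_grid {R : realType} (a r : R) (n : nat) : 0 < r -> (0 < n)%N ->
  exists c : 'I_n -> R, (forall k, `|c k - a| < r) /\
    forall y, `|y - a| < r -> exists k, `|c k - y| <= r / n%:R.
Proof.
move=> r0 n0; have nR : 0 < n%:R :> R by rewrite ltr0n.
pose h := r / n%:R; have h0 : 0 < h by exact: divr_gt0.
have rE : r = h * n%:R by rewrite /h divfK// gt_eqF.
rewrite -/h; clearbody h; subst r.
exists (fun k => a - h * n%:R + (2 * k%:R + 1) * h); split=> [k|y].
  have kn : k.+1%:R <= n%:R :> R by rewrite ler_nat.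
  have : 0 <= k%:R :> R by [].
  rewrite -natr1 in kn => k0; rewrite ltr_norml; apply/andP; split; nra.
rewrite ltr_norml => /andP[ya1 ya2].
(* [u] is the position of [y] measured in subintervals; its integer part
   is the index of the subinterval that contains [y]. *)
pose u := (y - a + h * n%:R) / (2 * h).
have uE : y - a + h * n%:R = 2 * h * u.
  by rewrite /u [RHS]mulrC divfK// mulf_neq0// gt_eqF.
have u0 : 0 <= u by rewrite divr_ge0; lra.
have un : u < n%:R by rewrite ltr_pdivrMr ?mulr_gt0//; lra.
have /andP[ku uk] := truncn_itv u0.
have kn : (Num.truncn u < n)%N by rewrite truncn_lt_nat.
exists (Ordinal kn) => /=; rewrite -natr1 in uk.
by rewrite ler_norml; apply/andP; split; nra.
Qed.

Lemma rV_norm_leP {R : realType} {d : nat} (x : 'rV[R]_d) (e : R) : 0 <= e ->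
  reflect (forall j, `|x 0 j| <= e) (`|x| <= e).
Proof.
move=> e0; rewrite [`|x|]mx_normrE; apply: (iffP (bigmax_leP _ _ _ _)) => /=.
  by move=> [_ xe] j; exact: (xe (0, j)).
by move=> xe; split=> // -[i j] _ /=; rewrite ord1.
Qed.

Lemma rV_norm_ltP {R : realType} {d : nat} (x : 'rV[R]_d) (e : R) : 0 < e ->
  reflect (forall j, `|x 0 j| < e) (`|x| < e).
Proof.
move=> e0; rewrite [`|x|]mx_normrE; apply: (iffP (bigmax_ltP _ _ _ _)) => /=.
  by move=> [_ xe] j; exact: (xe (0, j)).
by move=> xe; split=> // -[i j] _ /=; rewrite ord1.
Qed.

Lemma cube_grid {R : realType} {d : nat} (p0 : 'rV[R]_d) (r : R) (n : nat) :
  0 < r -> (0 < n)%N ->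
  exists c : {ffun 'I_d -> 'I_n} -> 'rV[R]_d, (forall k, `|c k - p0| < r) /\
    forall p, `|p - p0| < r -> exists k, `|c k - p| <= r / n%:R.
Proof.
move=> r0 n0.
have [c Hc] := choice (fun j => interval_grid (p0 0 j) r n r0 n0).
exists (fun k => \row_j c j (k j)); split=> [k|p].
  by apply/rV_norm_ltP => // j; rewrite !mxE; exact: (Hc j).1.
move=> /(rV_norm_ltP _ _ r0) pr.
have /choice[k Hk] : forall j, exists k, `|c j k - p 0 j| <= r / n%:R.
  by move=> j; apply: (Hc j).2; have := pr j; rewrite !mxE.
exists (finfun k); apply/rV_norm_leP; first by rewrite divr_ge0// ltW.
by move=> j; rewrite !mxE ffunE.
Qed.

Lemma grid_size {R : realType} (a e : R) : 0 <= a -> 0 < e ->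
  exists n, [/\ (0 < n)%N, a / n%:R < e & n%:R <= a / e + 1].
Proof.
move=> a0 e0; have ae : 0 <= a / e by rewrite divr_ge0// ltW.
exists (Num.truncn (a / e)).+1; have /andP[h1 h2] := truncn_itv ae; split=> //.
  by rewrite ltr_pdivrMr// mulrC -ltr_pdivrMr.
by rewrite -natr1 lerD2r.
Qed.

(** * Graphs of Hoelder functions over a Lipschitz cube *)

(** The count is [n^d * m], where [n] cells per side, at most
    [(L * r + 1) / eps], bring the centres within distance [eps] in [X], and [m]
    heights, at most [(C + 2) * eps^(gamma - 1)], exhaust the oscillation
    [C * eps^gamma] over one cell with gaps smaller than [eps]. *)
Lemma covering_growth_graph_cube {R : realType} {X : Type} {d : nat}
    (rho : X -> X -> R) (phi : 'rV[R]_d -> X) (p0 : 'rV[R]_d) (r L gamma : R)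
    (f : X -> R) : 0 < r -> 0 <= L -> 0 < gamma < 1 ->
  (forall p q, `|p - p0| < r -> `|q - p0| < r ->
     0 <= rho (phi p) (phi q) <= L * `|p - q|) ->
  hoelder_continuous rho gamma f ->
  covering_growth (prod_dist rho (@abs_dist R))
    [set (phi p, f (phi p)) | p in [set p | `|p - p0| < r]]
    ((d%:R + 1) - gamma).
Proof.
move=> r0 L0 /andP[g0 g1] lip [C C0 hf].
exists ((L * r + 1) ^+ d * (C + 2)) => eps /andP[e0 e1].
have [n [n0 nlt nle]] := grid_size (L * r) eps (mulr_ge0 L0 (ltW r0)) e0.
(* [C + 1] instead of [C]: the heights above a cell then lie strictly inside
   the interval covered by the grid. *)
pose H := (C + 1) * eps `^ gamma.
have pg : 0 < eps `^ gamma by exact: powR_gt0.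
have H0 : 0 < H by rewrite mulr_gt0// addr_gt0.
have [m [m0 mlt mle]] := grid_size H eps (ltW H0) e0.
have [c [cin ccov]] := cube_grid p0 r n r0 n0.
have [t Ht] := choice (fun k => interval_grid (f (phi (c k))) H m H0 m0).
exists #|{: {ffun 'I_d -> 'I_n} * 'I_m}|.
  apply: (covered_by_finType _ (fun i => (phi (c i.1), t i.1 i.2)) (fun=> eps)).
    by move=> _; rewrite e0 lexx.
  move=> _ [p pin <-]; have [k kp] := ccov _ pin.
  have /andP[rho0 rhole] := lip _ _ (cin k) pin.
  have rhoe : rho (phi (c k)) (phi p) < eps.
    rewrite (le_lt_trans rhole)// (le_lt_trans _ nlt)// -mulrA.
    by rewrite ler_wpM2l.
  have [j kj] : exists j, `|t k j - f (phi p)| <= H / m%:R.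
    apply: (Ht k).2; rewrite distrC (le_lt_trans (hf _ _))//.
    rewrite /H mulrDl mul1r ltr_pwDr// ler_wpM2l ?(ltW C0)//.
    by rewrite ge0_ler_powR ?(ltW g0) ?nnegrE ?(ltW e0)// ltW.
  exists (k, j); rewrite /prod_dist /abs_dist /= gt_max rhoe /=.
  exact: le_lt_trans mlt.
rewrite card_prod card_ffun !card_ord natrM natrX.
have -> : - (d%:R + 1 - gamma) = - d%:R + (gamma - 1) :> R by ring.
rewrite powRD; last by rewrite (gt_eqF e0) implybT.
have pg1 : eps `^ (gamma - 1) = eps `^ gamma / eps.
  rewrite powRD; last by rewrite (gt_eqF e0) implybT.
  by rewrite powR_inv1 // ltW.
have V1 : 1 <= eps^-1 by rewrite invf_ge1// ltW.
(* Both roundings up are absorbed in the constants: [1 <= eps^-1] and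
   [1 <= eps^(gamma - 1)]. *)
have pg2 : 1 <= eps `^ (gamma - 1).
  rewrite pg1 ler_pdivlMr// mul1r -[leLHS]powRr1 ?(ltW e0)//.
  by rewrite ger_powR ?(ltW g1)// e0 ltW.
rewrite powRN powR_mulrn ?(ltW e0)// -exprVn mulrACA -exprMn ler_pM//.
  rewrite lerXn2r ?nnegrE//.
    by rewrite mulr_ge0 ?invr_ge0 ?(ltW e0)// addr_ge0// mulr_ge0// ltW.
  by rewrite (le_trans nle)// [leRHS]mulrDl mul1r lerD2l.
rewrite (le_trans mle)// /H -mulrA -pg1.
have -> : C + 2 = C + 1 + 1 by ring.
by rewrite [leRHS]mulrDl mul1r lerD2l.
Qed.

(** * Segments of a Euclidean space *)

Definition segment {R : realType} {d : nat} (p q : 'rV[R]_d)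
    (t : R) : 'rV[R]_d :=
  p + t *: (q - p).

Lemma segment0 {R : realType} {d : nat} (p q : 'rV[R]_d) : segment p q 0 = p.
Proof. by rewrite /segment scale0r addr0. Qed.

Lemma segment1 {R : realType} {d : nat} (p q : 'rV[R]_d) : segment p q 1 = q.
Proof. by rewrite /segment scale1r addrC subrK. Qed.

(** Balls are convex. *)
Lemma segment_ball {R : realType} {d : nat} (p0 p q : 'rV[R]_d) (r t : R) :
  `|p - p0| < r -> `|q - p0| < r -> 0 <= t <= 1 -> `|segment p q t - p0| < r.
Proof.
move=> pr qr /andP[t0 t1].
have -> : segment p q t - p0 = (1 - t) *: (p - p0) + t *: (q - p0).
  by apply/matrixP => i j; rewrite !mxE; ring.
rewrite (le_lt_trans (ler_normD _ _))// !normrZ (ger0_norm t0).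
rewrite ger0_norm ?subr_ge0//.
set m := Num.max `|p - p0| `|q - p0|.
have mr : m < r by rewrite gt_max pr.
have pm : `|p - p0| <= m by rewrite le_max lexx.
have qm : `|q - p0| <= m by rewrite le_max lexx orbT.
by apply: le_lt_trans mr; nra.
Qed.

Lemma segment_continuous {R : realType} {d : nat} (p q : 'rV[R]_d) :
  continuous (segment p q).
Proof.
move=> t; rewrite /segment; apply: cvgD; first exact: cvg_cst.
by apply: cvgZr_tmp; exact: cvg_id.
Qed.

(** Along a segment the difference quotients of [F \o segment p q] are those of
    [F] in the direction [q - p], term by term. *)
Lemma derivable_segment {R : realType} {d : nat} {W : normedModType R}
    (F : 'rV[R]_d -> W) (p q : 'rV[R]_d) (t : R) :
  differentiable F (segment p q t) -> derivable (F \o segment p q) t 1.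
Proof.
move=> /(diff_derivable (v := q - p)).
rewrite /derivable; set G := (X in cvg (X @ _)) => HG.
set H := (X in cvg (X @ _)); suff -> : H = G by [].
apply/funext => h; rewrite /H /G /=; congr (_ *: (F _ - _)).
by rewrite /segment scalerDl [h *: _]mulr1 addrCA.
Qed.

Lemma derive1_segment {R : realType} {d : nat} {W : normedModType R}
    (F : 'rV[R]_d -> W) (p q : 'rV[R]_d) (t : R) :
  derive1 (F \o segment p q) t = 'D_(q - p) F (segment p q t).
Proof.
rewrite derive1E /derive.
set H := (X in lim (X @ _)); set G := (X in _ = lim (X @ _)).
suff -> : H = G by [].
apply/funext => h; rewrite /H /G /=; congr (_ *: (F _ - _)).
by rewrite /segment scalerDl [h *: _]mulr1 addrCA.
Qed.

(** * Lengths of coordinate segments *)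

Lemma bilin_le {R : realType} {d : nat} (G : 'M[R]_d) (v : 'rV[R]_d) :
  bilin G v v <= (\sum_i \sum_j `|G i j|) * `|v| ^+ 2.
Proof.
have vj k : `|v 0 k| <= `|v| by exact: (rV_norm_leP _ _ (normr_ge0 v) (lexx _)).
rewrite /bilin mxE exchange_big/= mulr_suml.
apply: ler_sum => j _; rewrite !mxE !mulr_suml; apply: ler_sum => i _.
rewrite (le_trans (ler_norm _))// !normrM.
have -> : `|v 0 i| * `|G i j| * `|v 0 j| =
    `|G i j| * (`|v 0 i| * `|v 0 j|) by ring.
by rewrite ler_wpM2l// expr2 ler_pM.
Qed.

(** The integral of a nonnegative function is the supremum of the integrals of
    the simple functions below it, hence monotone for arbitrary [g].  A bound
    of the speed of a curve at every time therefore bounds its length. *)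
Lemma Rintegral_unit_bound {R : realType} (g : R -> R) (B : R) :
  (forall t, 0 <= t <= 1 -> 0 <= g t <= B) ->
  0 <= \int[lebesgue_measure]_(t in `[0, 1]) g t <= B.
Proof.
move=> gB.
have g01 t : `[0, 1]%classic t -> (0 <= (g t)%:E)%E.
  by rewrite /= in_itv/= lee_fin => /gB/andP[].
have B0 : 0 <= B by have /andP[] := gB 0 (introT andP (conj (lexx 0) ler01));
  exact: le_trans.
have I0 : (0 <= \int[lebesgue_measure]_(t in `[0%R, 1%R]) (g t)%:E)%E.
  exact: integral_ge0.
have IB : (\int[lebesgue_measure]_(t in `[0%R, 1%R]) (g t)%:E <= B%:E)%E.
  have -> : B%:E = (\int[@lebesgue_measure R]_(t in `[0%R, 1%R]) cst B%:E t)%E.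
    rewrite integral_cst//.
    have mu01 := lebesgue_measure_itv `[0 : R, 1].
    rewrite /= lte_fin ltr01 -EFinB subr0 in mu01.
    by rewrite [X in (_ * X)%E](_ : _ = 1%E) ?mule1.
  rewrite !ge0_integralE//=.
  apply: le_ereal_sup => _ [h /= hg <-]; exists h => // t.
  apply: (le_trans (hg t)); rewrite /patch; case: ifPn => //.
  by rewrite inE/= in_itv/= lee_fin => /gB/andP[].
rewrite /Rintegral fine_ge0//= -lee_fin fineK// ge0_fin_numE//.
by rewrite (le_lt_trans IB)// ltry.
Qed.

Section charts.
Context {R : realType} {d : nat} {X : topologicalType}
  (M : riemannian_manifold R d X).
Implicit Types (h k : chart R d X) (p q : 'rV[R]_d).

Lemma overlap_image h k p : (cmap h @` cdom h) p -> cdom k (cinv h p) ->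
  (cmap h @` (cdom h `&` cdom k)) p.
Proof.
by move=> [x hx <-]; rewrite cmapK// => kx; exists x.
Qed.

(** Read in another chart [k], the lifted segment is the transition map
    [F = cmap k \o cinv h] along the segment; its velocity is the directional
    derivative ['D_(q - p) F], which is continuous as [F] is smooth. *)
Lemma segment_C1_curve h p q : atlas M h ->
  (forall t, 0 <= t <= 1 -> (cmap h @` cdom h) (segment p q t)) ->
  C1_curve M (cinv h \o segment p q).
Proof.
move=> Ah pq; exists (segment p q @^-1` (cmap h @` cdom h)); split.
- apply: open_comp; last exact: cimg_open.
  by move=> t _; exact: segment_continuous.
- by move=> t; rewrite /= in_itv/= => /pq.
move=> t /= ht; split.
  apply: continuous_comp; first exact: segment_continuous.
  exact: cinv_continuous.
move=> k Ak kt; set F := cmap k \o cinv h.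
have Vt := overlap_image _ _ _ ht kt.
have [Fdiff FC] := atlas_smooth Ah Ak 1.
rewrite -/F in Fdiff FC.
split; first exact: (derivable_segment F _ _ _ (Fdiff _ Vt)).
have -> : derive1 (cmap k \o (cinv h \o segment p q)) =
    (fun s => 'D_(q - p) F (segment p q s)).
  by apply/funext => s; exact: (derive1_segment F).
apply: (@continuous_comp _ _ _ (segment p q) ('D_(q - p) F)).
  exact: segment_continuous.
exact: FC.
Qed.

(** The speed is defined in the chart chosen at the current point; by the
    transformation law of the metric it can be computed in the chart [h], where
    the velocity is the constant [q - p]. *)
Lemma speed_segment h p q t : atlas M h ->
  (cmap h @` cdom h) (segment p q t) ->
  speed M (cinv h \o segment p q) t =
  Num.sqrt (bilin (metric M h (segment p q t)) (q - p) (q - p)).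
Proof.
move=> Ah [x hx xE]; rewrite /speed /chart_at /=.
case: (cid2 _) => k /= Ak kt.
have xt : cinv h (segment p q t) = x by rewrite -xE cmapK.
rewrite xt in kt *.
rewrite (derive1_segment (cmap k \o cinv h)) -xE.
by rewrite (metric_compat Ah Ak hx kt).
Qed.

Lemma path_length_ge0 (s : seq (R -> X)) : 0 <= path_length M s.
Proof.
by apply: sumr_ge0 => c _; apply: fine_ge0; apply: integral_ge0 => t _;
  rewrite lee_fin sqrtr_ge0.
Qed.

(** The distance is an infimum of lengths, so the single lifted segment bounds
    it from above; its speed is at most [Num.sqrt K * `|q - p|]. *)
Lemma riem_dist_segment_le h p q (K : R) : atlas M h ->
  (forall t, 0 <= t <= 1 -> (cmap h @` cdom h) (segment p q t) /\
     \sum_i \sum_j `|metric M h (segment p q t) i j| <= K) ->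
  0 <= riem_dist M (cinv h p) (cinv h q) <= Num.sqrt K * `|q - p|.
Proof.
move=> Ah pq.
set S := [set path_length M s | s in piecewise_C1_path M (cinv h p) (cinv h q)].
have Slb : lbound S 0 by move=> _ [s _ <-]; exact: path_length_ge0.
have Spq : S (path_length M [:: cinv h \o segment p q]).
  exists [:: cinv h \o segment p q] => //=.
  rewrite segment0 segment1; split=> //.
  by apply: segment_C1_curve => // t /pq[].
rewrite /riem_dist -/S lb_le_inf/=; [|by eexists; exact: Spq|exact: Slb].
apply: (le_trans (ge_inf _ Spq)); first by exists 0.
rewrite /path_length big_seq1.
suff /Rintegral_unit_bound/andP[_] : forall t, 0 <= t <= 1 ->
  0 <= speed M (cinv h \o segment p q) t <= Num.sqrt K * `|q - p| by [].
move=> t t01; have [imt Kt] := pq _ t01.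
rewrite speed_segment// sqrtr_ge0/=.
have K0 : 0 <= K.
  by apply: le_trans Kt; apply: sumr_ge0 => i _; exact: sumr_ge0.
rewrite -[X in _ * X]normr_id -sqrtr_sqr -sqrtrM//.
rewrite ler_wsqrtr// (le_trans (bilin_le _ _))//.
by rewrite ler_wpM2r// sqr_ge0.
Qed.

(** Shrinking a cube around the coordinates of [x], the entries of the metric
    exceed those at the centre by at most 1 in absolute value, by continuity;
    convexity of the cube keeps all the segments between its points inside. *)
Lemma chart_cube_lipschitz (x : X) : exists h p0 r L,
  [/\ 0 < r, 0 <= L,
    nbhs x (cinv h @` [set p | `|p - p0| < r]) &
    forall p q, `|p - p0| < r -> `|q - p0| < r ->
      0 <= riem_dist M (cinv h p) (cinv h q) <= L * `|p - q|].
Proof.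
have [h Ah hx] := atlas_cover M x.
pose p0 := cmap h x.
have imp0 : (cmap h @` cdom h) p0 by exists x.
pose K : R := \sum_i \sum_j (`|metric M h p0 i j| + 1).
have : \forall p \near p0, (cmap h @` cdom h) p /\
    forall i j, `|metric M h p i j| < `|metric M h p0 i j| + 1.
  apply: filterI; first by apply: open_nbhs_nbhs; split=> //; exact: cimg_open.
  pose near_p i j := [set p | `|metric M h p i j| < `|metric M h p0 i j| + 1].
  refine (filter_forall (F := nbhs p0)
    (f := fun i => [set p | forall j, near_p i j p]) _ _) => i.
  refine (filter_forall (F := nbhs p0) (f := near_p i) _ _) => j.
  have Cij := metric_smooth Ah i j 0 _ imp0.
  by apply: (cvgr_norm_lt _ Cij); rewrite ltrDl.
move=> /nbhs_ballP[r /= r0 Hr].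
have {}Hr p : `|p - p0| < r -> (cmap h @` cdom h) p /\
    \sum_i \sum_j `|metric M h p i j| <= K.
  rewrite distrC => pr; have [|imp Kp] := Hr p; first by rewrite -ball_normE.
  by split=> //; apply: ler_sum => i _; apply: ler_sum => j _; exact: ltW.
exists h, p0, r, (Num.sqrt K); split=> //.
- have nx : \forall y \near x, cdom h y.
    by apply: open_nbhs_nbhs; split=> //; exact: cdom_open.
  have nr : \forall y \near x, `|p0 - cmap h y| < r.
    exact: (cvgr_dist_lt _ _ (cmap_continuous hx)).
  near=> y; exists (cmap h y) => /=.
    by rewrite distrC; near: y.
  by rewrite cmapK//; near: y.
move=> p q pr qr; rewrite distrC; apply: riem_dist_segment_le => // t t01.
by apply: Hr; exact: segment_ball.
Unshelve. all: by end_near. Qed.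

End charts.

(** * From local to global, and the dimension bound *)

(** If the whole space did not satisfy [P], the complements of the sets that do
    would form a proper filter; a neighbourhood of a cluster point [x] that
    satisfies [P] has its complement in the filter and so cannot exist. *)
Lemma compact_local_to_global {X : topologicalType} (P : set X -> Prop) :
  compact [set: X] -> P set0 ->
  (forall A B, A `<=` B -> P B -> P A) ->
  (forall A B, P A -> P B -> P (A `|` B)) ->
  (forall x : X, exists2 U : set X, nbhs x U & P U) -> P [set: X].
Proof.
move=> cX P0 PS PU Ploc; apply: contrapT => nPX.
pose F : set_system X := [set A | P (~` A)].
have FF : ProperFilter F.
  split; first by rewrite /F /= setC0.
  split; rewrite /F /=.
  - by rewrite setCT.
  - by move=> A B PA PB /=; rewrite setCI; exact: PU.
  - by move=> A B AB; apply: PS; exact: subsetC.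
have [|x [_ clx]] := cX F FF; first exact: filterT.
have [U nU PUx] := Ploc x.
have /clx : F (~` U) by rewrite /F /= setCK.
by move=> /(_ U nU) [y []].
Qed.

Theorem corollary5p5 (R : realType) (d : nat) (X : topologicalType)
    (M : riemannian_manifold R d X)
    (Xcompact : compact [set: X]) (Xconnected : connected [set: X])
    (gamma : R) (gamma01 : 0 < gamma < 1)
    (f : X -> R) (f_hoelder : hoelder_continuous (riem_dist M) gamma f) :
  (upper_minkowski_dim (prod_dist (riem_dist M) (@abs_dist R)) (graph f)
     <= ((d%:R + 1) - gamma)%:E)%E.
Proof.
apply: covering_growth_dim.
apply: (compact_local_to_global (fun A => covering_growth
  (prod_dist (riem_dist M) (@abs_dist R)) [set (x, f x) | x in A]
  ((d%:R + 1) - gamma)) Xcompact).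
- by rewrite image_set0; exact: covering_growth0.
- by move=> A B AB; apply: covering_growthS; exact: image_subset.
- by move=> A B; rewrite image_setU; exact: covering_growthU.
move=> x; have [h [p0 [r [L [r0 L0 nx lip]]]]] := chart_cube_lipschitz M x.
exists (cinv h @` [set p | `|p - p0| < r]) => //.
rewrite image_comp.
exact: (covering_growth_graph_cube _ (cinv h) p0 r L).
Qed.
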